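(* Let $\lambda$ be a partition of $n$ and $n=kd$ with $k,d$ positive integers. For a positive integer $N$, write $\gamma_N=(1,2,\dots,N)$, and for a partition $\nu$ of $N$, a divisor $e$ of $N$ and an integer $j$, let $\theta^{\nu,j}_{e^{N/e}}=|C_{S_N}(\gamma_N^{N/e})\cap S_{\nu,j}|$. (1) If there is some $r\in[n]$ such that $d$ does not divide $r\,m_r(\lambda)$, then $\theta^{\lambda,j}_{d^k}=0$ for all $0\le j\le n-1$. (2) If $d$ divides $r\,m_r(\lambda)$ for all $r\in[n]$, then \[ \sum_{j=0}^{n-1}\theta^{\lambda,j}_{d^k}t^j=\binom{n/d}{\frac{1m_1(\lambda)}{d},\frac{2m_2(\lambda)}{d},\ldots,\frac{nm_n(\lambda)}{d}}\prod_{r=1}^n\sum_{j=0}^{rm_r(\lambda)-1}\theta^{r^{m_r(\lambda)},j}_{d^{rm_r(\lambda)/d}}t^j. \]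
   Context: Permutations act on the right; ${\rm exc}(\sigma)=|\{i\in[N-1]:i\sigma>i\}|$ for $\sigma\in S_N$. $S_{\nu,j}$ is the set of $\sigma\in S_N$ of cycle type $\nu$ with ${\rm exc}(\sigma)=j$. $m_r(\lambda)$ is the number of parts of $\lambda$ equal to $r$; $r^m$ is the partition with $m$ parts equal to $r$, and factors with $m_r(\lambda)=0$ are taken to be $1$. $C_{S_N}(g)$ is the centralizer of $g$ in $S_N$. *)

(* Defs.v *)
From mathcomp Require Import all_boot all_order all_algebra all_fingroup.

Set Implicit Arguments.
Unset Strict Implicit.
Unset Printing Implicit Defensive.

(* A partition is the weakly decreasing sequence of its (positive) parts. *)
Definition is_partition (n : nat) (lam : seq nat) : bool :=
  [&& sorted geq lam, all (leq 1) lam & sumn lam == n].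

Definition mpart (r : nat) (lam : seq nat) : nat := count_mem r lam.

(* S_N acts on 'I_N = {0, ..., N-1}; i : 'I_N stands for the letter i + 1. *)

Definition cycle_type (N : nat) (s : 'S_N) : seq nat :=
  sort geq [seq #|A| | A : {set 'I_N} <- enum (porbits s)].

(* The letters of [N - 1] are the i : 'I_N with i.+1 < N. *)
Definition exc (N : nat) (s : 'S_N) : nat :=
  #|[set i : 'I_N | (i.+1 < N) && (i < s i)]|.

Definition gamma (N : nat) : 'S_N := perm (@ordS_inj N).

Definition Snuj (N : nat) (nu : seq nat) (j : nat) : {set 'S_N} :=
  [set s : 'S_N | (cycle_type s == nu) && (exc s == j)].

(* [theta N e nu j] is theta^{nu,j}_{e^{N/e}}, for e dividing N. *)
Definition theta (N e : nat) (nu : seq nat) (j : nat) : nat :=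
  #|'C[gamma N ^+ (N %/ e)]%g :&: Snuj N nu j|.

(* The division is exact whenever the entries of s sum to m. *)
Definition multinomial_coef (m : nat) (s : seq nat) : nat :=
  m`! %/ \prod_(a <- s) a`!.

(* Main.v *)
(** If sigma commutes with tau = gamma^k, then tau maps cycles of sigma to cycles
    of the same length, so the set X_r of letters lying in r-cycles is a union of
    tau-orbits, i.e. of residue classes mod k. As these classes all have d
    elements, d divides |X_r| = r m_r, which gives (1).

    For (2), sigma is determined by the coloring of the k residue classes by cycle
    lengths together with its restrictions to the sets X_r; there are
    multinomially many colorings. The increasing bijection from X_r to an
    initial segment preserves excedances and turns tau into the power of the long
    cycle that defines theta for r^(m_r), so each X_r contributes the factor
    indexed by r. *)
Require Import Defs.
From mathcomp Require Import all_boot all_order all_algebra all_fingroup.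
From mathcomp Require Import zify.

Set Implicit Arguments.
Unset Strict Implicit.
Unset Printing Implicit Defensive.

Import GRing.Theory.

(** * Commuting permutations and their orbits *)

Lemma cent1_permP (T : finType) (s t : {perm T}) :
  reflect (forall x, s (t x) = t (s x)) (s \in 'C[t]%g).
Proof.
apply: (iffP cent1P) => [cst x | cst]; last by apply/permP=> x; rewrite !permM.
by rewrite -!permM (cst : s * t = t * s)%g.
Qed.

(** Serves both for [h] a permutation commuting with [s1] and for [h] an embedding along which a
    permutation is extended. *)
Lemma porbit_semiconj (T1 T2 : finType) (h : T1 -> T2) (s1 : {perm T1})
    (s2 : {perm T2}) (y : T1) :
  (forall z, s2 (h z) = h (s1 z)) -> porbit s2 (h y) = h @: porbit s1 y.
Proof.
move=> hs; have hsX i z : (s2 ^+ i)%g (h z) = h ((s1 ^+ i)%g z).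
  by elim: i z => [|i IHi] z; rewrite ?expg0 ?perm1 // !expgS !permM hs IHi.
apply/setP=> x; apply/porbitP/imsetP=> [[i ->] | [z /porbitP[i ->] ->]].
  by exists ((s1 ^+ i)%g y); rewrite ?mem_porbit.
by exists i.
Qed.

Lemma card_porbit_cent (T : finType) (s t : {perm T}) (x : T) :
  s \in 'C[t]%g -> #|porbit s (t x)| = #|porbit s x|.
Proof.
move=> /cent1_permP cst.
by rewrite (porbit_semiconj _ cst) card_imset //; apply: perm_inj.
Qed.

Lemma porbit_eq_on (T : finType) (X : {set T}) (s t : {perm T}) (x : T) :
    (forall y, y \in X -> s y \in X) -> (forall y, y \in X -> s y = t y) ->
  x \in X -> porbit s x = porbit t x.
Proof.
move=> sX st xX.
have stX i : (s ^+ i)%g x \in X /\ (s ^+ i)%g x = (t ^+ i)%g x.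
  elim: i => [|i [IHX IHe]]; first by rewrite !expg0 perm1.
  by rewrite !expgSr !permM -IHe sX // st.
by apply/setP=> y; apply/porbitP/porbitP=> [] [i ->]; exists i; case: (stX i).
Qed.

(** * Splitting a weighted sum over permutations along a coloring *)

Section Weights.

Local Open Scope ring_scope.

(** A product over letters factors along any partition of the letters; [exc_step] below specializes
    it to the excedance monomial. *)
Definition perm_weight (R : comNzRingType) (T : finType) (e : T -> T -> R)
  (s : {perm T}) : R := \prod_x e x (s x).

(** Colors are kept apart from lengths: the product over colors needs a finite color type, whereas
    the rectangular case uses a constant natural number. *)
Definition color_perms (T : finType) (I : Type) (tau : {perm T})
    (len : I -> nat) (C : T -> I) : {set {perm T}} :=
  [set s in 'C[tau]%g | [forall x, #|porbit s x| == len (C x)]].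

(** A permutation of a block is kept as one of all of [T], so that the pieces on different blocks
    have the same type. *)
Definition block_perms (T : finType) (tau : {perm T}) (X : {set T}) (r : nat) :
    {set {perm T}} :=
  [set s in 'C[tau]%g | perm_on X s && [forall x in X, #|porbit s x| == r]].

Lemma block_perms0 (T : finType) (tau : {perm T}) (r : nat) :
  block_perms tau set0 r = [set 1%g].
Proof.
apply/setP=> s; rewrite inE in_set1; apply/idP/eqP=> [/and3P[_ s0 _]|->].
  by apply/permP=> x; rewrite perm1 (out_perm s0) // inE.
by rewrite perm_on1 group1 /=; apply/forall_inP=> x; rewrite inE.
Qed.

Lemma perm_weight1 (R : comNzRingType) (T : finType) (e : T -> T -> R) :
  (forall x, e x x = 1) -> perm_weight e 1%g = 1.
Proof. by move=> e1; rewrite /perm_weight big1 // => x _; rewrite perm1. Qed.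

Lemma perm_weight_on (R : comNzRingType) (T : finType) (e : T -> T -> R)
    (X : {set T}) (s : {perm T}) :
  (forall x, e x x = 1) -> perm_on X s ->
  perm_weight e s = \prod_(x in X) e x (s x).
Proof.
move=> e1 sX; rewrite /perm_weight (bigID (mem X)) /= [X in _ * X]big1 ?mulr1 //.
by move=> x xX; rewrite (out_perm sX).
Qed.

(** Cycle length is constant on cycles and [len] is injective, so the permutations on the left
    preserve each fibre of [C]. They amount to independent choices on the fibres; as these are
    [tau]-stable, commutation with [tau] can be tested on each fibre. *)
Lemma sum_color_perms (R : comNzRingType) (T I : finType) (e : T -> T -> R)
    (tau : {perm T}) (len : I -> nat) (C : T -> I) :
    (forall x, e x x = 1) -> injective len -> (forall x, C (tau x) = C x) ->
  \sum_(s in color_perms tau len C) perm_weight e s =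
  \prod_i \sum_(s in block_perms tau (C @^-1: [set i]) (len i)) perm_weight e s.
Proof.
move=> e1 len_inj Ctau; pose X i := C @^-1: [set i].
have inX x i : (x \in X i) = (C x == i) by rewrite !inE.
(* The product of sums becomes a sum over families with one block permutation per color; [split]
   will be the bijection onto these families. *)
rewrite bigA_distr_big_dep.
pose split s := [ffun i => restr_perm (X i) s].
have permC s x : s \in color_perms tau len C -> C (s x) = C x.
  rewrite inE => /andP[_ /forallP sC]; apply: len_inj.
  rewrite -(eqP (sC x)) -(eqP (sC (s x))).
  by have := porbit_perm s 1 x; rewrite expg1 => ->.
have splitE s i x : s \in color_perms tau len C ->
    split s i x = if C x == i then s x else x.
  move=> sA; rewrite ffunE; case: ifP => Cx; last first.
    by apply: (out_perm (restr_perm_on _ _)); rewrite inX Cx.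
  apply: restr_permE; last by rewrite inX.
  by apply/astabsP=> y /=; rewrite !inX permC.
have split_inj : {in color_perms tau len C &, injective split}.
  move=> s t sA tA est; apply/permP=> x.
  have := congr1 (fun f : {ffun I -> {perm T}} => f (C x) x) est.
  by rewrite !splitE // eqxx.
have split_img : split @: color_perms tau len C
    = [set f in family (fun i => block_perms tau (X i) (len i))].
  apply/setP=> f; rewrite inE; apply/imsetP/familyP=> [[s sA ->] i | fB].
    have := sA; rewrite [s \in _]inE => /andP[/cent1_permP cs /forallP sC].
    rewrite inE; apply/and3P; split.
    - apply/cent1_permP=> x; rewrite !splitE // Ctau; by case: eqP.
    - by rewrite ffunE restr_perm_on.
    apply/forall_inP=> x xX; rewrite -(@porbit_eq_on _ (X i) s) //.
    + by move: xX; rewrite inX => /eqP <-.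
    + by move=> y; rewrite !inX permC.
    by move=> y; rewrite inX splitE // => ->.
  have fBP i : [/\ forall x, f i (tau x) = tau (f i x), perm_on (X i) (f i) &
      forall x, C x = i -> #|porbit (f i) x| = len i].
    have := fB i; rewrite inE => /and3P[/cent1_permP ? ? /forall_inP fl].
    by split=> // x Cx; apply/eqP/fl; rewrite inX Cx.
  (* Gluing: each letter is moved by the member of the family that has its color. *)
  pose g x := f (C x) x.
  have Cg x : C (g x) = C x.
    have [_ fi _] := fBP (C x); have := perm_closed x fi.
    by rewrite !inX eqxx => /eqP.
  have g_inj : injective g.
    move=> x y exy; have Cxy : C x = C y by rewrite -Cg exy Cg.
    by move: exy; rewrite /g Cxy => /perm_inj.
  have gA : perm g_inj \in color_perms tau len C.
    rewrite inE; apply/andP; split.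
      by apply/cent1_permP=> x; rewrite !permE /g Ctau; case: (fBP (C x)) => ->.
    apply/forallP=> x; have [_ fi fl] := fBP (C x).
    rewrite -(fl x) // (@porbit_eq_on _ (X (C x)) _ (f (C x))) //.
    + by move=> y; rewrite !inX permE Cg.
    + by move=> y; rewrite inX permE /g => /eqP->.
    by rewrite inX.
  exists (perm g_inj) => //; apply/ffunP=> i; apply/permP=> x.
  rewrite splitE // permE /g; case: eqP => [-> // | /eqP Cx].
  by have [_ fi _] := fBP i; rewrite (out_perm fi) // inX.
transitivity (\sum_(f in split @: color_perms tau len C)
   \prod_i perm_weight e (f i)); last first.
  by rewrite split_img; apply: eq_bigl => f; rewrite inE.
rewrite big_imset //; apply: eq_bigr => s sA.
rewrite /perm_weight (partition_big C predT) //=; apply: eq_bigr => i _.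
rewrite -/(perm_weight e (split s i)) (@perm_weight_on _ _ _ (X i)) //; last first.
  by rewrite ffunE restr_perm_on.
apply: eq_big => [x|x Cx]; first by rewrite inX.
by rewrite splitE // Cx.
Qed.

(** * Transport of permutations along an injection *)

Section Extension.

Variables (T1 T2 : finType) (h : T1 -> T2) (h_inj : injective h).

Definition ext_fun (s : {perm T1}) (x : T2) : T2 :=
  if [pick y | h y == x] is Some y then h (s y) else x.

Lemma ext_fun_h s y : ext_fun s (h y) = h (s y).
Proof.
rewrite /ext_fun; case: pickP => [z /eqP/h_inj-> // | /(_ y)].
by rewrite eqxx.
Qed.

Lemma ext_fun_out s x : x \notin h @: [set: T1] -> ext_fun s x = x.
Proof.
rewrite /ext_fun; case: pickP => // z /eqP <-.
by rewrite imset_f.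
Qed.

Lemma ext_fun_inj s : injective (ext_fun s).
Proof.
apply: (can_inj (g := ext_fun s^-1%g)) => x.
have [/imsetP[y _ ->] | xh] := boolP (x \in h @: [set: T1]).
  by rewrite !ext_fun_h permK.
by rewrite !ext_fun_out.
Qed.

Definition ext_perm s : {perm T2} := perm (ext_fun_inj (s := s)).

Lemma ext_permE s y : ext_perm s (h y) = h (s y).
Proof. by rewrite permE ext_fun_h. Qed.

Lemma ext_perm_on s : perm_on (h @: [set: T1]) (ext_perm s).
Proof.
apply/subsetP=> x; apply: contraR => xh.
by rewrite permE ext_fun_out.
Qed.

Lemma ext_perm_inj : injective ext_perm.
Proof.
move=> s t est; apply/permP=> y; apply: h_inj.
by rewrite -!ext_permE est.
Qed.

Lemma ext_perm_surj (u : {perm T2}) :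
  perm_on (h @: [set: T1]) u -> exists s, u = ext_perm s.
Proof.
move=> uh.
have P y : {z | u (h y) = h z}.
  apply: sig_eqW.
  have: u (h y) \in h @: [set: T1] by rewrite perm_closed // imset_f.
  by case/imsetP=> z _ ->; exists z.
pose g y := sval (P y); have gE y : u (h y) = h (g y) := svalP (P y).
have g_inj : injective g.
  by move=> y z eyz; apply/h_inj/(@perm_inj _ u); rewrite !gE eyz.
exists (perm g_inj); apply/permP=> x.
have [/imsetP[y _ ->] | xh] := boolP (x \in h @: [set: T1]).
  by rewrite ext_permE permE gE.
by rewrite (out_perm uh) // permE ext_fun_out.
Qed.

End Extension.

(** Extension by the identity is a bijection between the two index sets: it keeps orbit sizes on the
    image of [h], and [h] intertwines [tau1] with [tau2]. Letters outside the image are fixed and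
    weigh 1. *)
Lemma sum_block_perms (R : comNzRingType) (T1 T2 : finType) (h : T1 -> T2)
    (e1 : T1 -> T1 -> R) (e2 : T2 -> T2 -> R) (tau1 : {perm T1})
    (tau2 : {perm T2}) (r : nat) :
    injective h -> (forall y, tau2 (h y) = h (tau1 y)) ->
    (forall y z, e2 (h y) (h z) = e1 y z) -> (forall x, e2 x x = 1) ->
  \sum_(s in block_perms tau2 (h @: [set: T1]) r) perm_weight e2 s =
  \sum_(s in color_perms tau1 id (fun=> r)) perm_weight e1 s.
Proof.
move=> h_inj htau he e2x.
have card_ext s y : #|porbit (ext_perm h_inj s) (h y)| = #|porbit s y|.
  by rewrite (porbit_semiconj (s1 := s)) ?card_imset // => z; rewrite ext_permE.
(* [tau2] maps the finite image of [h] injectively into itself, hence onto itself, so the complement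
   is stable too. *)
have htau' x : (tau2 x \in h @: [set: T1]) = (x \in h @: [set: T1]).
  suff im : tau2 @: (h @: [set: T1]) = h @: [set: T1].
    by rewrite -{1}im mem_imset //; apply: perm_inj.
  apply/eqP; rewrite eqEcard (card_imset _ (@perm_inj _ tau2)) leqnn andbT.
  by apply/subsetP=> _ /imsetP[_ /imsetP[y _ ->] ->]; rewrite htau imset_f.
have ->: block_perms tau2 (h @: [set: T1]) r =
    ext_perm h_inj @: color_perms tau1 id (fun=> r).
  apply/setP=> u; apply/idP/imsetP=> [|[s sA ->{u}]].
    rewrite inE => /and3P[/cent1_permP cu uh /forall_inP ur].
    have [s us] := ext_perm_surj h_inj uh; exists s => //.
    rewrite inE; apply/andP; split; last first.
      by apply/forallP=> y; rewrite -card_ext -us ur // imset_f.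
    apply/cent1_permP=> y; apply: (h_inj).
    by rewrite -(ext_permE h_inj) -!htau -us cu us ext_permE.
  move: sA; rewrite inE => /andP[/cent1_permP cs /forallP sr].
  rewrite inE ext_perm_on; apply/andP; split; last first.
    by apply/forall_inP=> _ /imsetP[y _ ->]; rewrite card_ext sr.
  apply/cent1_permP=> x.
  have [/imsetP[y _ ->] | xh] := boolP (x \in h @: [set: T1]).
    by rewrite htau !ext_permE cs htau.
  by rewrite !(out_perm (ext_perm_on h_inj s)) ?htau'.
rewrite big_imset; last by move=> s t _ _; apply: ext_perm_inj.
apply: eq_bigr => s _; rewrite (perm_weight_on e2x (ext_perm_on h_inj s)).
rewrite big_imset /=; last by move=> y z _ _; apply: (h_inj).
rewrite /perm_weight; apply: eq_big => y; first by rewrite inE.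
by rewrite ext_permE he.
Qed.

End Weights.

(** * Words with prescribed letter multiplicities *)

(** Induction on the length, splitting by the first letter [i]: deleting it lowers [a i] by one, so
    these words contribute [a i * k!], and the [a i] add up to [k + 1]. *)
Lemma card_tuple_counts (I : finType) (k : nat) (a : I -> nat) :
  \sum_i a i = k ->
  #|[set t : k.-tuple I | [forall i, count_mem i t == a i]]| * \prod_i (a i)`!
    = k`!.
Proof.
elim: k a => [|k IHk] a suma.
  have a0 i : a i = 0 by apply/eqP; rewrite -leqn0 -suma (bigD1 i) ?leq_addr.
  rewrite big1 => [|i _]; last by rewrite a0.
  rewrite muln1 fact0 (_ : [set _ | _] = setT) ?cardsT ?card_tuple //.
  by apply/setP=> t; rewrite !inE tuple0; apply/forallP=> i; rewrite a0.
rewrite -sum1dep_card.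
rewrite (reindex (fun p : I * k.-tuple I => [tuple of p.1 :: p.2])) /=; last first.
  exists (fun t => (thead t, [tuple of behead t])) => [[i t] _ | t _] /=.
    by congr pair; apply: val_inj.
  by rewrite -tuple_eta.
rewrite -(pair_big_dep xpredT (fun i (t : k.-tuple I) =>
  [forall j, (i == j) + count_mem j t == a j]) (fun _ _ => 1)) /=.
rewrite big_distrl /= factS -suma big_distrl /=; apply: eq_bigr => i _.
(* A letter of multiplicity 0 cannot come first, and both sides vanish. *)
case ai: (a i) => [|b].
  rewrite big_pred0 ?mul0n // => t; apply/negbTE/negP=> /forallP/(_ i).
  by rewrite eqxx ai.
pose a' j := if j == i then b else a j.
have aa' j : a j = (i == j) + a' j.
  by rewrite /a' (eq_sym i); case: eqP => [->|_]; rewrite ?ai.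
rewrite sum1dep_card -(IHk a'); last first.
  apply/eqP; rewrite -eqSS -suma (bigD1 i) //= [in X in _ == X](bigD1 i) //=.
  rewrite aa' eqxx -addnA add1n eqSS; apply/eqP; congr (_ + _).
  by apply: eq_bigr => j ji; rewrite aa' eq_sym (negbTE ji).
rewrite (bigD1 i) //= [in RHS](bigD1 i) //= ai factS /a' eqxx -!mulnA mulnCA.
congr (_ * (_ * (_ * _))); last first.
  by apply: eq_bigr => j ji; rewrite (negbTE ji).
apply: eq_card => t; rewrite !inE; apply: eq_forallb => j.
by rewrite -/(a' j) aa' eqn_add2l.
Qed.

(** * Cycle type in terms of orbit sizes *)

Lemma card_porbit_class (n : nat) (s : 'S_n) (r : nat) :
  #|[set x | #|porbit s x| == r]| = r * count_mem r (cycle_type s).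
Proof.
rewrite count_sort count_map -sum1_count big_enum_cond.
rewrite mulnC big_distrl /= -sum1dep_card.
rewrite (partition_big (porbit s) [pred A in porbits s | #|A| == r]) /=; last first.
  by move=> x ->; rewrite imset_f.
apply: eq_bigr => A /andP[/imsetP[y _ ->] /eqP <-].
rewrite mul1n -[RHS]sum1_card; apply: eq_bigl => x.
rewrite eq_porbit_mem andb_idl // -eq_porbit_mem.
by move=> /eqP ->.
Qed.

(** Weakly decreasing sequences with equal multiplicities coincide, and the multiplicity of [r] is
    recovered by cancelling [r]. *)
Lemma cycle_typeP (n : nat) (s : 'S_n) (lam : seq nat) :
  sorted geq lam -> all (leq 1) lam ->
  reflect (forall r, 0 < r -> #|[set x | #|porbit s x| == r]| = r * mpart r lam)
          (cycle_type s == lam).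
Proof.
move=> lam_sorted lam_pos; apply: (iffP eqP) => [<- r _|slam].
  exact: card_porbit_class.
have geq_total : total geq by move=> x y; apply: leq_total.
have geq_trans : transitive geq by move=> x y z yx xz; apply: leq_trans xz yx.
have geq_anti : antisymmetric geq by move=> x y; rewrite andbC; apply: anti_leq.
apply: (sorted_eq geq_trans geq_anti) => //; first exact: sort_sorted.
(* The value 0 cannot be cancelled; it occurs on neither side, as orbits are nonempty and parts
   positive. *)
apply/allP=> r _ /=; apply/eqP; case: r => [|r].
  have -> : count_mem 0 lam = 0.
    by apply/count_memPn/negP=> /(allP lam_pos).
  apply/count_memPn/negP; rewrite mem_sort => /mapP[A].
  rewrite mem_enum => /imsetP[y _ ->] /esym/eqP.
  by rewrite (negbTE (card_porbit_neq0 _ _)).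
by apply/eqP; rewrite -(eqn_pmul2l (ltn0Sn r)) -card_porbit_class slam.
Qed.

(** * Powers of the long cycle and unions of residue classes *)

Lemma gammaXE (n j : nat) (x : 'I_n) :
  (gamma n ^+ j)%g x = (x + j) %% n :> nat.
Proof.
elim: j => [|j IHj]; first by rewrite expg0 perm1 addn0 modn_small.
by rewrite expgSr permM permE /= IHj -addn1 modnDml addn1 addnS.
Qed.

Lemma modn_gammaX (k d : nat) (x : 'I_(k * d)) :
  (gamma (k * d) ^+ k)%g x = x %[mod k].
Proof. by rewrite gammaXE modn_dvdm ?dvdn_mulr // modnDr. Qed.

(** In increasing order, the letters with residue in [A] form [d] consecutive copies of [A], each
    shifted by [k] from the previous one. Moving to the next copy is a shift by [k] in the target
    and by [#|A|] in the source. *)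
Lemma residue_classes_embed (k d : nat) (A : {set 'I_k}) :
  exists h : 'I_(#|A| * d) -> 'I_(k * d),
    [/\ forall y z, (h y < h z) = (y < z),
        forall y, (gamma (k * d) ^+ k)%g (h y) = h ((gamma (#|A| * d) ^+ #|A|)%g y)
      & h @: [set: _] = [set x : 'I_(k * d) | [exists i in A, x %% k == i]]].
Proof.
pose L := map val (enum A); pose a := #|A|; rewrite -/a.
have sizeL : size L = a by rewrite size_map -cardE.
have memL i : (i \in L) = [exists j in A, i == val j].
  apply/mapP/exists_inP=> [[j jA ->]|[j jA /eqP->]]; exists j => //.
    by rewrite -mem_enum.
  by rewrite mem_enum.
have L_lt p : p < a -> nth 0 L p < k.
  rewrite -sizeL => /(mem_nth 0) /mapP[j _ ->]; exact: ltn_ord.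
have L_sorted : sorted ltn L.
  rewrite /L {1}/enum_mem -enumT.
  apply: (subseq_sorted ltn_trans (s2 := map val (enum 'I_k))).
    exact/map_subseq/filter_subseq.
  by rewrite val_enum_ord iota_ltn_sorted.
have L_mono p q : p < q -> q < a -> nth 0 L p < nth 0 L q.
  move=> pq qa; apply: (sorted_ltn_nth ltn_trans) => //; rewrite inE sizeL //.
  exact: ltn_trans qa.
(* The quotient of [y] by [a] selects the copy, the remainder the position in the increasing list
   [L] of [A]. *)
pose g y := (y %/ a) * k + nth 0 L (y %% a).
have g_lt y : y < a * d -> g y < k * d.
  move=> yad; have a0 : 0 < a by move: yad; case: (a).
  have qd : y %/ a < d by rewrite ltn_divLR // (mulnC d a).
  have := L_lt _ (ltn_pmod y a0); rewrite /g; nia.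
have g_mono y z : y < z -> z < a * d -> g y < g z.
  move=> yz zad; have a0 : 0 < a by move: zad; case: (a).
  have := leq_div2r a (ltnW yz); rewrite leq_eqVlt => /orP[/eqP eq_q|lt_q].
    rewrite /g eq_q ltn_add2l L_mono ?ltn_pmod //.
    by move: yz; rewrite {1}(divn_eq y a) {1}(divn_eq z a) eq_q ltn_add2l.
  have := L_lt _ (ltn_pmod y a0); rewrite /g; nia.
pose h (y : 'I_(a * d)) : 'I_(k * d) := Ordinal (g_lt y (ltn_ord y)).
exists h; split.
- move=> y z /=; case: (ltngtP y z) => [yz|zy|->]; last by rewrite ltnn.
    by rewrite g_mono.
  by apply/negbTE; rewrite -leqNgt ltnW ?g_mono.
- move=> y; apply: ord_inj; rewrite gammaXE /= /g gammaXE.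
  move: (nat_of_ord y) (ltn_ord y) => {}y yad.
  have a0 : 0 < a by move: yad; case: (a).
  have qd : y %/ a < d by rewrite ltn_divLR // (mulnC d a).
  have lt_k := L_lt _ (ltn_pmod y a0); have lt_a := ltn_pmod y a0.
  (* Before the last copy nothing wraps around; from the last copy both shifts return to the first
     one. *)
  have [lt_d|ge_d] := ltnP (y %/ a).+1 d.
    have e1 : y + a < a * d by rewrite {1}(divn_eq y a); nia.
    rewrite (modn_small e1) modnDr divnDr ?dvdnn // divnn a0 modn_small; nia.
  have {ge_d} ed : (y %/ a).+1 = d by apply/eqP; rewrite eqn_leq qd.
  have ->: (y + a) %% (a * d) = y %% a.
    rewrite {1}(divn_eq y a) (_ : _ + a = y %% a + a * d); last by rewrite -ed; nia.
    by rewrite modnDr modn_small // (leq_trans lt_a) // leq_pmulr // -ed.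
  rewrite modn_mod (divn_small lt_a) mul0n add0n.
  rewrite (_ : _ + k = nth 0 L (y %% a) + k * d); last by rewrite -ed; nia.
  by rewrite modnDr modn_small // (leq_trans lt_k) // leq_pmulr // -ed.
apply/setP=> x; rewrite inE -memL; apply/imsetP/idP=> [[y _ ->]|xL].
  have a0 : 0 < a by case: (a) y => [|//] [].
  rewrite /= /g modnMDl modn_small ?L_lt ?ltn_pmod //.
  by rewrite mem_nth // sizeL ltn_pmod.
have ia : index (x %% k) L < a by rewrite -sizeL index_mem.
have k0 : 0 < k by case: (k) x {xL ia} => [|//] [].
have qd : x %/ k < d by rewrite ltn_divLR // (mulnC d k).
(* The inverse of [g]: same copy, position of the residue in [L]. *)
have y_lt : (x %/ k) * a + index (x %% k) L < a * d by nia.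
exists (Ordinal y_lt) => //; apply: val_inj; rewrite /= /g.
rewrite modnMDl divnMDl ?(leq_ltn_trans _ ia) // (divn_small ia) addn0.
rewrite (modn_small ia).
by rewrite nth_index // -divn_eq.
Qed.

Lemma card_residue_classes (k d : nat) (A : {set 'I_k}) :
  #|[set x : 'I_(k * d) | [exists i in A, x %% k == i]]| = #|A| * d.
Proof.
have [h [h_lt _ <-]] := residue_classes_embed d A.
rewrite card_imset ?cardsT ?card_ord // => y z eyz.
by apply: val_inj; case: (ltngtP y z) => //; rewrite -h_lt eyz ltnn.
Qed.

(** * The excedance generating polynomial as a weighted sum *)

Section ExcedancePolynomial.

Local Open Scope ring_scope.

(** Only the relative order of a letter and its image matters, so increasing maps preserve this
    weight; a fixed letter gives 1. *)
Definition exc_step (n : nat) (x y : 'I_n) : {poly int} := 'X^(x < y)%N.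

(** The last letter is never an excedance; hence the range of [j] below [n] covers every
    permutation. *)
Lemma exc_lt (n : nat) (s : 'S_n) : (0 < n)%N -> (exc s < n)%N.
Proof.
case: n s => // n s _; rewrite -[X in (_ < X)%N]card_ord -cardsT proper_card //.
rewrite properT; apply/eqP=> /setP/(_ ord_max); by rewrite !inE /= ltnn.
Qed.

Lemma perm_weight_exc (n : nat) (s : 'S_n) :
  perm_weight (@exc_step n) s = 'X^(exc s).
Proof.
rewrite /perm_weight /exc_step -expr_sum; congr ('X^_).
rewrite /exc -sum1dep_card [RHS]big_mkcond /=; apply: eq_bigr => x _.
(* The condition [x.+1 < n] is automatic, since [x < s x < n]. *)
rewrite andb_idl => [|xs]; first by case: ltnP.
exact: leq_trans (ltn_ord (s x)).
Qed.

Lemma sum_theta (n e : nat) (nu : seq nat) : (0 < n)%N ->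
  \sum_(0 <= j < n) (theta n e nu j)%:R *: 'X^j =
  \sum_(s in 'C[gamma n ^+ (n %/ e)]%g | cycle_type s == nu)
     perm_weight (@exc_step n) s.
Proof.
move=> n0; rewrite big_mkord.
rewrite (partition_big (fun s => Ordinal (exc_lt s n0)) xpredT) //=.
apply: eq_bigr => j _; rewrite scaler_nat /theta -sumr_const.
apply: eq_big => [s|s]; first by rewrite in_setI [s \in Snuj _ _ _]inE andbA.
by rewrite in_setI [s \in Snuj _ _ _]inE perm_weight_exc => /and3P[_ _ /eqP->].
Qed.

End ExcedancePolynomial.

(** * Multiplicities in tuples and partitions *)

Lemma count_mem_tnth (I : finType) (k : nat) (t : k.-tuple I) (i : I) :
  count_mem i t = #|[set j | tnth t j == i]|.
Proof. by rewrite -sum1_count big_tuple sum1dep_card. Qed.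

Lemma mpart_gt (n r : nat) (lam : seq nat) :
  is_partition n lam -> n < r -> mpart r lam = 0.
Proof.
move=> /and3P[_ _ /eqP <-] lam_r; apply/count_memPn; apply: contraL lam_r.
rewrite -leqNgt; elim: lam => //= x lam IHlam; rewrite inE => /orP[/eqP->|/IHlam].
  exact: leq_addr.
by move/leq_trans; apply; apply: leq_addl.
Qed.

Lemma mpart0 (n : nat) (lam : seq nat) : is_partition n lam -> mpart 0 lam = 0.
Proof. by move=> /and3P[_ lam_pos _]; apply/count_memPn/negP=> /(allP lam_pos). Qed.

Lemma sum_mpart (n : nat) (lam : seq nat) :
  is_partition n lam -> \sum_(r < n.+1) r * mpart r lam = n.
Proof.
move=> lamP; have /and3P[_ _ /eqP lam_n] := lamP.
have: all (leq^~ n) lam.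
  apply/allP=> r rlam; rewrite /= leqNgt; apply/negP=> /(mpart_gt lamP).
  by move/count_memPn; rewrite rlam.
rewrite -[RHS]lam_n; elim: (lam) => [|x l IHl] /=.
  by rewrite big1 // => r _; rewrite muln0.
move=> /andP[xn ln]; rewrite -(IHl ln).
under eq_bigr do rewrite mulnDr; rewrite big_split /=; congr (_ + _).
rewrite (bigD1 (Ordinal (xn : x < n.+1))) //= eqxx muln1 big1 ?addn0 // => r rx.
have /negbTE-> : x != r by apply: contra rx => /eqP xr; apply/eqP/val_inj.
by rewrite muln0.
Qed.

(** * Orbit sizes are constant on residue classes *)

Section CyclicCentralizer.

Variables (k d : nat) (k_gt0 : 0 < k) (d_gt0 : 0 < d).

Definition residue (x : 'I_(k * d)) : 'I_k := Ordinal (ltn_pmod x k_gt0).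

Definition residue_repr (i : 'I_k) : 'I_(k * d) :=
  widen_ord (leq_pmulr k d_gt0) i.

Lemma residueK : cancel residue_repr residue.
Proof. by move=> i; apply: val_inj; rewrite /= modn_small. Qed.

Lemma residue_gammaX x : residue ((gamma (k * d) ^+ k)%g x) = residue x.
Proof. by apply: val_inj; apply: modn_gammaX. Qed.

Lemma card_residue_preim (A : {set 'I_k}) : #|residue @^-1: A| = #|A| * d.
Proof.
rewrite -(card_residue_classes d A); apply: eq_card => x; rewrite !inE.
apply/idP/exists_inP=> [xA|[i iA /eqP xi]]; first by exists (residue x).
by rewrite (_ : residue x = i) //; apply: val_inj.
Qed.

(** The letter [x] is reached from the least letter of its class by the power [x %/ k] of
    [gamma ^+ k], which commutes with [s]. *)
Lemma card_porbit_residue (s : 'S_(k * d)) x :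
  s \in 'C[gamma (k * d) ^+ k]%g ->
  #|porbit s x| = #|porbit s (residue_repr (residue x))|.
Proof.
move=> cs.
rewrite -[in RHS](@card_porbit_cent _ s ((gamma (k * d) ^+ k) ^+ (x %/ k))%g).
  congr #|porbit s _|; apply: ord_inj; rewrite -expgM gammaXE /=.
  by rewrite addnC (mulnC k (x %/ k)) -divn_eq modn_small.
by rewrite cent1C groupX // cent1C.
Qed.

Lemma card_porbit_class_residue (s : 'S_(k * d)) (r : nat) :
  s \in 'C[gamma (k * d) ^+ k]%g ->
  #|[set x | #|porbit s x| == r]| =
  #|[set i | #|porbit s (residue_repr i)| == r]| * d.
Proof.
move=> cs; rewrite -card_residue_preim; apply: eq_card => x.
by rewrite !inE -card_porbit_residue.
Qed.

End CyclicCentralizer.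

(** * All cycles of one length *)

Section Rectangular.

Local Open Scope ring_scope.

Lemma cycle_type_nseq (r m : nat) (s : 'S_(r * m)) : (0 < r)%N -> (0 < m)%N ->
  (cycle_type s == nseq m r) = [forall x, #|porbit s x| == r].
Proof.
move=> r0 m0; have srt : sorted geq (nseq m r).
  by elim: (m) => // [] [|m'] //= ->; rewrite /geq /= leqnn.
have pos : all (leq 1) (nseq m r) by rewrite all_nseq r0 orbT.
apply/(cycle_typeP s srt pos)/forallP=> [sP x | sP r' r'0].
  have /eqP := sP r r0; rewrite /mpart count_nseq /= eqxx mul1n.
  rewrite -[X in _ == X]card_ord -cardsT => /eqP cX.
  have /eqP XT : [set x | #|porbit s x| == r] == setT.
    by rewrite eqEcard subsetT cX leqnn.
  by have := in_setT x; rewrite -XT inE.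
rewrite /mpart count_nseq /=; have [<-|rr'] := eqVneq r r'.
  rewrite mul1n -[RHS]card_ord -cardsT.
  by apply: eq_card => x; rewrite !inE sP.
rewrite mul0n muln0; apply: eq_card0 => x; rewrite !inE (eqP (sP x)).
exact: negbTE.
Qed.

(** The size [a * d] is the one produced by [residue_classes_embed]; the equation identifies the two
    ordinal types. *)
Lemma sum_theta_nseq (r m a d : nat) : (0 < r)%N -> (0 < m)%N -> (0 < d)%N ->
    (a * d = r * m)%N ->
  \sum_(0 <= j < r * m) (theta (r * m) d (nseq m r) j)%:R *: 'X^j =
  \sum_(s in color_perms (gamma (a * d) ^+ a)%g id (fun=> r))
     perm_weight (@exc_step (a * d)) s.
Proof.
move=> r0 m0 d0 rm; have rm_d : (r * m %/ d = a)%N by rewrite -rm mulnK.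
rewrite sum_theta ?muln_gt0 ?r0 // rm_d rm.
by apply: eq_bigl => s; rewrite [in RHS]inE cycle_type_nseq.
Qed.

End Rectangular.

(** * Assembly of both claims *)

Local Open Scope ring_scope.

Theorem theorem5p8 (n k d : nat) (lam : seq nat)
    (hlam : is_partition n lam) (hk : (0 < k)%N) (hd : (0 < d)%N)
    (hn : n = (k * d)%N) :
  ((exists r : nat, (1 <= r <= n)%N /\ ~~ (d %| r * mpart r lam)%N) ->
     forall j : nat, (0 <= j <= n - 1)%N -> theta n d lam j = 0%N)
  /\
  ((forall r : nat, (1 <= r <= n)%N -> (d %| r * mpart r lam)%N) ->
     \sum_(0 <= j < n) (theta n d lam j)%:R *: 'X^j =
       (multinomial_coef (n %/ d)
          [seq (r * mpart r lam) %/ d | r <- iota 1 n]%N)%:R *: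
       \prod_(1 <= r < n.+1 | (0 < mpart r lam)%N)
          \sum_(0 <= j < r * mpart r lam)
             (theta (r * mpart r lam) d (nseq (mpart r lam) r) j)%:R *: 'X^j
       :> {poly int}).
Proof.
subst n; set tau := (gamma (k * d) ^+ k)%g.
have n0 : (0 < k * d)%N by rewrite muln_gt0 hk.
have [lam_sorted lam_pos _] := and3P hlam.
(* Both claims rest on this count of the residue classes made of letters in [r]-cycles. *)
have class_card s r : s \in 'C[tau]%g -> cycle_type s = lam ->
    (#|[set i | #|porbit s (residue_repr hd i)| == r]| * d = r * mpart r lam)%N.
  move=> cs <-; rewrite /mpart -card_porbit_class.
  by rewrite (card_porbit_class_residue hk hd).
split=> [[r [_ /negP ndr]] j _|dvd_d].
  apply: eq_card0 => s; apply/negP; rewrite in_setI mulnK // => /andP[cs].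
  rewrite inE => /andP[/eqP slam _]; case: ndr.
  by rewrite -(class_card s) // dvdn_mull.
rewrite sum_theta // mulnK // -/tau.
pose a r := ((r * mpart r lam) %/ d)%N.
(* Divisibility is assumed only for [r] from 1 to [n]; elsewhere the product is 0. *)
have aK r : (a r * d = r * mpart r lam)%N.
  rewrite divnK //; case: (posnP r) => [-> //|r0].
  have [rn|/(mpart_gt hlam) ->] := leqP r (k * d); last by rewrite muln0.
  by rewrite dvd_d ?r0.
pose good (c : k.-tuple 'I_(k * d).+1) := [forall r : 'I__, count_mem r c == a r].
(* Orbit sizes are at most [n], so [inord] never falls back to its default. *)
pose col (s : 'S_(k * d)) : k.-tuple 'I_(k * d).+1 :=
  [tuple inord #|porbit s (residue_repr hd i)| | i < k].
have colE s i : tnth (col s) i = #|porbit s (residue_repr hd i)| :> nat.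
  rewrite tnth_mktuple inordK // ltnS -[X in (_ <= X)%N]card_ord; exact: max_card.
have card_good : #|[set c | good c]| =
    multinomial_coef k [seq a r | r <- iota 1 (k * d)].
  have suma : (\sum_(r < (k * d).+1) a r)%N = k.
    apply/eqP; rewrite -(eqn_pmul2r hd) big_distrl /=.
    by under eq_bigr do rewrite aK; rewrite (sum_mpart hlam).
  have := card_tuple_counts suma; rewrite /multinomial_coef => <-.
  (* Color 0 is used by no class; its factor [0!] is dropped to match the list starting at 1. *)
  rewrite big_map -[X in iota 1 X](subn1 (k * d).+1) big_ord_recl /=.
  have -> : a 0%N = 0%N by rewrite /a mul0n div0n.
  rewrite fact0 mul1n big_add1 big_mkord mulnK //.
  by apply: prodn_gt0 => r; apply: fact_gt0.
rewrite (partition_big col good) /=; last first.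
  move=> s /andP[cs /eqP slam]; apply/forallP=> r.
  rewrite -(eqn_pmul2r hd) aK -(class_card s r cs slam) count_mem_tnth.
  apply/eqP; congr (_ * _)%N; apply: eq_card => i; by rewrite !inE -colE.
(* The multinomial multiple becomes a constant sum over good colorings, so each coloring has to
   contribute the same product. *)
rewrite scaler_nat -card_good -sumr_const.
apply: eq_big => [c|c good_c]; first by rewrite inE.
pose A r := [set i | tnth c i == r].
have cardA r : #|A r| = a r by rewrite -count_mem_tnth; apply/eqP/(forallP good_c).
pose C (x : 'I_(k * d)) := tnth c (residue hk x).
have preimC r : C @^-1: [set r] = residue hk @^-1: A r.
  by apply/setP=> x; rewrite !inE.
(* For a good coloring, prescribing the orbit sizes already forces cycle type [lam]. *)
transitivity (\sum_(s in color_perms tau (@nat_of_ord (k * d).+1) C)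
    perm_weight (@exc_step (k * d)) s).
  apply: eq_bigl => s; rewrite [in RHS]inE -andbA.
  have [cs|//] := boolP (s \in 'C[tau]%g); rewrite /=.
  apply/andP/forallP=> [[_ /eqP colc] x | sC].
    by rewrite (card_porbit_residue hk hd) // -colE colc.
  split; last first.
    apply/eqP/eq_from_tnth=> i; apply: val_inj; rewrite /= colE (eqP (sC _)).
    by rewrite /C residueK.
  apply/(cycle_typeP s lam_sorted lam_pos) => r _.
  have [rn|rn] := ltnP r (k * d).+1; last first.
    rewrite (mpart_gt hlam) // muln0; apply: eq_card0 => x; rewrite !inE.
    by rewrite (eqP (sC x)) ltn_eqF // (leq_trans (ltn_ord _)).
  rewrite -aK -(cardA (Ordinal rn)) -(card_residue_preim d hk) -preimC.
  by apply: eq_card => x; rewrite !inE (eqP (sC x)).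
rewrite sum_color_perms; last first.
- by move=> x; rewrite /C residue_gammaX.
- exact: val_inj.
- by move=> x; rewrite /exc_step ltnn.
(* For [mpart r lam = 0] the sum over [j] is empty, hence 0; the value 1 is the weight of the
   identity, the only permutation of an empty block. *)
pose F r := if (0 < mpart r lam)%N then \sum_(0 <= j < r * mpart r lam)
  (theta (r * mpart r lam) d (nseq (mpart r lam) r) j)%:R *: 'X^j
  else 1 : {poly int}.
have block (r : 'I_(k * d).+1) : \sum_(s in block_perms tau (C @^-1: [set r]) r)
    perm_weight (@exc_step (k * d)) s = F r.
  rewrite /F preimC; case: posnP => [m0|m0].
    have /eqP : #|A r| = 0%N by rewrite cardA /a m0 muln0 div0n.
    rewrite cards_eq0 => /eqP ->; rewrite preimset0 block_perms0 big_set1.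
    by rewrite perm_weight1 // => x; rewrite /exc_step ltnn.
  have r0 : (0 < r)%N.
    by rewrite lt0n; apply/negP=> /eqP r0; move: m0; rewrite r0 (mpart0 hlam).
  rewrite (@sum_theta_nseq r (mpart r lam) #|A r|) //; last by rewrite cardA aK.
  have [h [h_lt h_tau h_im]] := residue_classes_embed d (A r).
  have -> : residue hk @^-1: A r = h @: [set: _].
    rewrite h_im; apply/setP=> x; rewrite !in_set.
    apply/idP/exists_inP=> [xA|[i iA /eqP xi]].
      by exists (residue hk x); rewrite ?inE.
    move: iA; rewrite inE; congr (tnth c _ == _); exact: val_inj.
  apply: sum_block_perms => // [y z eyz|y z|x]; last by rewrite /exc_step ltnn.
    by apply: val_inj; case: (ltngtP y z) => //; rewrite -h_lt eyz ltnn.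
  by rewrite /exc_step h_lt.
(* The factor at [r = 0] is 1 and is split off. *)
rewrite (eq_bigr _ (fun r _ => block r)) -(big_mkord xpredT F) big_ltn //.
by rewrite {1}/F (mpart0 hlam) mul1r [RHS]big_mkcond.
Qed.
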